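(* Let $A\in\mathbb{R}^{p\times n}$ and $B\in\mathbb{R}^{p\times m}$ satisfy $\operatorname{rge} B\subset \operatorname{rge} A$. Let $$\mathcal{D}(A,B)=\left\{\left(Y,-\tfrac12 YY^T\right)\in\mathbb{R}^{n\times m}\times\mathbb{S}^n \;\middle|\; Y\in\mathbb{R}^{n\times m},\ AY=B\right\}.$$ Then the closed convex hull of $\mathcal{D}(A,B)$ is $\overline{\mathrm{conv}}\,\mathcal{D}(A,B)=\Omega(A,B)$, where $$\Omega(A,B)=\left\{(Y,W)\in\mathbb{R}^{n\times m}\times\mathbb{S}^n \;\middle|\; AY=B\ \text{ and }\ \tfrac12 YY^T+W\in\mathcal{K}_A^\circ\right\}.$$
   Context: $\mathbb{S}^n$ is the space of real symmetric $n\times n$ matrices with inner product $\langle V,W\rangle=\mathrm{tr}(VW)$, and $\mathbb{R}^{n\times m}\times\mathbb{S}^n$ carries the inner product $\langle (Y,W),(X,V)\rangle=\mathrm{tr}(Y^TX)+\mathrm{tr}(WV)$. $\operatorname{rge}$ denotes the range (column space). $\mathcal{K}_A:=\{V\in\mathbb{S}^n \mid u^TVu\ge 0\ \text{for all } u\in\ker A\}$, a convex cone, and $\mathcal{K}_A^\circ:=\{W\in\mathbb{S}^n\mid \langle W,V\rangle\le 0\ \text{for all } V\in\mathcal{K}_A\}$ is its polar cone. The closed convex hull $\overline{\mathrm{conv}}\,S$ is the closure of the convex hull of $S$. *)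

(* Defs.v *)
From HB Require Import structures.
From mathcomp Require Import all_boot all_order all_algebra.
From mathcomp Require Import all_classical all_reals all_analysis.

Set Implicit Arguments.
Unset Strict Implicit.
Unset Printing Implicit Defensive.

Import Order.TTheory GRing.Theory Num.Theory.
Import numFieldNormedType.Exports.

Local Open Scope classical_set_scope.
Local Open Scope ring_scope.

Definition conv_hull (R : realType) (E : lmodType R) (S : set E) : set E :=
  smallest (@convex_set R E) S.

Section Matrices.
Variable R : realType.

Definition rge (p n : nat) (A : 'M[R]_(p, n)) : set 'cV[R]_p :=
  range (fun x : 'cV[R]_n => A *m x).

Definition ker (p n : nat) (A : 'M[R]_(p, n)) : set 'cV[R]_n :=
  [set u | A *m u = 0].

(* S^n is represented as a closed subset of 'M[R]_n rather than as a type of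
   its own: closures taken in 'M[R]_n and in S^n agree for subsets of S^n. *)
Definition symmx (n : nat) : set 'M[R]_n := [set V | V^T = V].

Definition KA (p n : nat) (A : 'M[R]_(p, n)) : set 'M[R]_n :=
  [set V | symmx V /\ forall u, ker A u -> 0 <= (u^T *m V *m u) 0 0].

(* The polar is taken in S^n, so its elements are symmetric. *)
Definition polar (n : nat) (K : set 'M[R]_n) : set 'M[R]_n :=
  [set W | symmx W /\ forall V, K V -> \tr (W *m V) <= 0].

Definition Dset (p n m : nat) (A : 'M[R]_(p, n)) (B : 'M[R]_(p, m)) :
    set ('M[R]_(n, m) * 'M[R]_n) :=
  [set (Y, - (2^-1 *: (Y *m Y^T))) | Y in [set Y | A *m Y = B]].

Definition Omega (p n m : nat) (A : 'M[R]_(p, n)) (B : 'M[R]_(p, m)) :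
    set ('M[R]_(n, m) * 'M[R]_n) :=
  [set YW | [/\ symmx YW.2, A *m YW.1 = B &
              polar (KA A) (2^-1 *: (YW.1 *m YW.1^T) + YW.2)]].

End Matrices.

(* Main.v *)
Require Import Defs.
From HB Require Import structures.
From mathcomp Require Import all_boot all_order all_algebra.
From mathcomp Require Import all_classical all_reals all_analysis.
From mathcomp Require Import ring lra.

Set Implicit Arguments.
Unset Strict Implicit.
Unset Printing Implicit Defensive.

Import Order.TTheory GRing.Theory Num.Theory.
Import numFieldNormedType.Exports.

Local Open Scope classical_set_scope.
Local Open Scope ring_scope.

(* Omega is closed, contains D, and is convex since on {AY = B}
     a Y1 Y1^T + b Y2 Y2^T - (a Y1 + b Y2)(a Y1 + b Y2)^T
       = a b (Y1 - Y2)(Y1 - Y2)^T   (a + b = 1),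
   where the columns of Y1 - Y2 lie in ker A.
   Conversely, testing W in the polar of K_A against u u^T and - A^T A shows
   W = - C C^T / 2 with AC = 0, so a point of Omega is
   (Y, - (Y Y^T + C C^T) / 2).  It lies in conv D itself: for v in ker A, the
   midpoint of the points built from Y + v e^T and Y - v e^T, e a unit vector
   of R^m, trades one column v of C. *)

(** * Gram traces and factorization of positive semidefinite matrices *)

Lemma mxtrace_mulmx_tr_ge0 (R : realDomainType) (m n : nat) (X : 'M[R]_(m, n)) :
  0 <= \tr (X *m X^T).
Proof.
apply: sumr_ge0 => i _; rewrite mxE; apply: sumr_ge0 => j _.
by rewrite mxE -expr2 sqr_ge0.
Qed.

(** The trace is the sum of the squares of all entries of [X]. *)
Lemma mxtrace_mulmx_tr_eq0 (R : realDomainType) (m n : nat)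
    (X : 'M[R]_(m, n)) : \tr (X *m X^T) <= 0 -> X = 0.
Proof.
move=> X_le0; have ge0 i j : 0 <= X i j * X^T j i.
  by rewrite mxE -expr2 sqr_ge0.
have tr0 : \tr (X *m X^T) = 0.
  by apply/eqP; rewrite eq_le X_le0 mxtrace_mulmx_tr_ge0.
apply/matrixP => i j; rewrite mxE.
have diag_ge0 k : 0 <= (X *m X^T) k k by rewrite mxE; apply: sumr_ge0.
have rowi0 : \sum_j X i j * X^T j i = 0.
  by have := psumr_eq0P (fun k _ => diag_ge0 k) tr0 (i := i) isT; rewrite mxE.
have /eqP := psumr_eq0P (fun k _ => ge0 i k) rowi0 (i := j) isT.
by rewrite mxE mulf_eq0 orbb => /eqP.
Qed.

(** For fixed [u] the form is a quadratic polynomial in the free first coordinate [t]; suitable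
    values of [t] give the facts needed for the Cholesky step. *)
Lemma block_quadratic_form (R : comNzRingType) (n : nat) (a t : R)
    (b : 'rV[R]_n) (N : 'M[R]_n) (u : 'cV[R]_n) :
  ((col_mx t%:M u)^T *m block_mx a%:M b b^T N *m col_mx t%:M u) 0 0 =
  a * t ^+ 2 + (t * (b *m u) 0 0) *+ 2 + (u^T *m N *m u) 0 0.
Proof.
have trbu : (u^T *m b^T) 0 0 = (b *m u) 0 0 by rewrite -trmx_mul mxE.
rewrite tr_col_mx mul_row_block mul_row_col tr_scalar_mx -scalar_mxM.
rewrite mulmxDl -scalar_mxM mulmxDl mul_mx_scalar mul_scalar_mx -scalemxAl.
move: (u^T *m b^T) (b *m u) (u^T *m N *m u) trbu => x y z xy.
by rewrite !mxE xy eqxx mulr1n; ring.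
Qed.

(* Cholesky: with M = [a, b; b^T, N], the first column of C is
   (sqrt a, b^T / sqrt a) and the rest factors the Schur complement
   N - b^T b / a.  If a = 0 then b = 0, so the junk value 0^-1 = 0 is right. *)
Lemma psd_factor (R : rcfType) (n : nat) (M : 'M[R]_n) :
  M^T = M -> (forall u : 'cV[R]_n, 0 <= (u^T *m M *m u) 0 0) ->
  exists C : 'M[R]_n, M = C *m C^T.
Proof.
elim: n M => [|n IHn] M symM psdM.
  by exists 0; apply/matrixP => -[].
change 'M[R]_(1 + n) in M.
pose a := M 0 0; pose b : 'rV[R]_n := ursubmx M; pose N := drsubmx M.
have defM : M = block_mx a%:M b b^T N.
  rewrite -[LHS]submxK trmx_ursub symM; congr block_mx.
  by rewrite [LHS]mx11_scalar !mxE; congr (M _ _)%:M; apply: val_inj.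
have symN : N^T = N by rewrite trmx_drsub symM.
have form_ge0 t (u : 'cV[R]_n) :
    0 <= a * t ^+ 2 + (t * (b *m u) 0 0) *+ 2 + (u^T *m N *m u) 0 0.
  by rewrite -block_quadratic_form -defM.
have a_ge0 : 0 <= a.
  by have := form_ge0 1 0; rewrite !mulmx0 mxE expr1n !mulr1 mulr0 mul0rn !addr0.
have b0 : a = 0 -> b = 0.
  move=> a0; set q := (b^T^T *m N *m b^T) 0 0.
  apply: mxtrace_mulmx_tr_eq0; rewrite /mxtrace big_ord1 leNgt.
  apply/negP => s_gt0.
  (* With a = 0 and s = b b^T > 0, the form at (t, b^T) is 2 t s + q, and this [t] makes it -1. *)
  have := form_ge0 (- (q + 1) / (2 * (b *m b^T) 0 0)) b^T.
  rewrite a0 mul0r add0r -/q => ge0.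
  suff : 0 <= -1 :> R by rewrite oppr_ge0 ler10.
  apply: le_trans ge0 _; rewrite le_eqVlt; apply/orP; left; apply/eqP.
  by field; rewrite gt_eqF.
pose S := N - a^-1 *: (b^T *m b).
have [||C defS] := IHn S.
- by rewrite /S linearB /= symN linearZ /= trmx_mul trmxK.
(* For a > 0 this [t] minimizes the polynomial, and the minimum is u^T S u. For a = 0 we have b = 0,
   so both sides reduce to u^T N u. *)
- move=> u; have := form_ge0 (- (b *m u) 0 0 / a) u.
  have -> : (u^T *m S *m u) 0 0 =
      (u^T *m N *m u) 0 0 - a^-1 * (b *m u) 0 0 ^+ 2.
    have buE : (u^T *m (b^T *m b) *m u) 0 0 = (b *m u) 0 0 ^+ 2.
      by rewrite mulmxA -trmx_mul -mulmxA mxE big_ord1 mxE expr2.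
    by rewrite /S mulmxBr mulmxBl -scalemxAr -scalemxAl 4!mxE buE.
  have [a0|an0] := eqVneq a 0; first by rewrite (b0 a0) mul0mx mxE; lra.
  move=> h; apply: le_trans h _; rewrite le_eqVlt; apply/orP; left; apply/eqP.
  by field.
pose r := Num.sqrt a.
have sqr_r : r ^+ 2 = a by rewrite sqr_sqrtr.
have rVb : (r * r^-1) *: b = b.
  have [r0|rn0] := eqVneq r 0; last by rewrite mulfV ?scale1r.
  by rewrite b0 ?scaler0// -sqr_r r0 expr0n.
pose L : 'M[R]_(1 + n) := block_mx r%:M 0 (r^-1 *: b^T) C.
exists L; suff : M = L *m L^T by [].
rewrite tr_block_mx mulmx_block !trmx0 !mul0mx !mulmx0 !addr0 tr_scalar_mx.
rewrite linearZ /= trmxK -defS -scalar_mxM -expr2 sqr_r mul_scalar_mx.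
rewrite mul_mx_scalar !scalerA -scalemxAl -scalemxAr scalerA -expr2 exprVn.
by rewrite sqr_r rVb -linearZ rVb addrC subrK.
Qed.

(** * The cone K_A and its polar *)

Section KA_polar.
Variables (R : realType) (p n : nat) (A : 'M[R]_(p, n)).

(** The trace is the sum of d^T V d over the columns d of [D], all of which lie in ker A. *)
Lemma trace_KA_ge0 (m : nat) (V : 'M[R]_n) (D : 'M[R]_(n, m)) :
  KA A V -> A *m D = 0 -> 0 <= \tr (D *m D^T *m V).
Proof.
move=> [_ V_ge0] AD0; rewrite -mulmxA mxtrace_mulC.
apply: sumr_ge0 => j _.
have -> : (D^T *m V *m D) j j = ((col j D)^T *m V *m col j D) 0 0.
  by rewrite tr_col -row_mul !mxE; apply: eq_bigr => k _; rewrite !mxE.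
by apply: V_ge0; rewrite /ker /= colE mulmxA AD0 mul0mx.
Qed.

Lemma polar_KA_factor (W : 'M[R]_n) : polar (KA A) W ->
  exists2 C : 'M[R]_n, A *m C = 0 & W = - (2^-1 *: (C *m C^T)).
Proof.
move=> [symW W_le0].
have [||C defW] := @psd_factor R n (- (2 *: W)).
- by rewrite linearN linearZ /= symW.
(* Pairing [W] with u u^T gives u^T W u <= 0, so -2 W is positive semidefinite. *)
- move=> u; have /W_le0 : KA A (u *m u^T).
    split=> [|v _]; first by rewrite /symmx /= trmx_mul trmxK.
    rewrite mulmxA -mulmxA -[v^T *m u]trmxK trmx_mul trmxK.
    by rewrite mxE big_ord1 mxE -expr2 sqr_ge0.
  rewrite mulmxA mxtrace_mulC mulmxA /mxtrace big_ord1 => uWu.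
  rewrite mulmxN mulNmx -scalemxAr -scalemxAl [leRHS]mxE [X in - X]mxE.
  by rewrite oppr_ge0 mulr_ge0_le0.
exists C; last first.
  by rewrite -defW scalerN opprK scalerA mulVf ?scale1r ?pnatr_eq0.
apply: mxtrace_mulmx_tr_eq0.
(* The form of - A^T A vanishes on ker A. Pairing it with [W] gives tr (A W A^T) >= 0, and tr (AC
   (AC)^T) = -2 tr (A W A^T). *)
have /W_le0 : KA A (- (A^T *m A)).
  split=> [|v Av0]; first by rewrite /symmx /= linearN /= trmx_mul trmxK.
  by rewrite mulmxN mulNmx -!mulmxA Av0 !mulmx0 oppr0 mxE.
rewrite mulmxN linearN /= mulmxA mxtrace_mulC mulmxA oppr_le0 => AWA_ge0.
rewrite trmx_mul mulmxA -(mulmxA A) -defW mulmxN mulNmx linearN /= oppr_le0.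
by rewrite -scalemxAr -scalemxAl linearZ /= mulr_ge0.
Qed.

End KA_polar.

(** * Convexity of Omega and the two inclusions before closure *)

Lemma convex_set_midpoint (R : numFieldType) (E : lmodType R) (S : set E)
    (x y : E) : @convex_set R E S -> S x -> S y -> S (2^-1 *: (x + y)).
Proof.
move=> cS Sx Sy; rewrite -inE.
have h0 : 0 <= 2^-1 :> R by rewrite invr_ge0.
have h1 : 2^-1 <= 1 :> R by rewrite invf_le1 ?ler1n.
suff <- : conv (Itv01 h0 h1) (x : convex_lmodType E) y = 2^-1 *: (x + y).
  by apply: cS; rewrite inE.
have halfC : 1 - 2^-1 = 2^-1 :> R by field.
by rewrite scalerDr -[in X in _ + X]halfC.
Qed.

Section Hull.
Variables (R : realType) (p n m : nat) (A : 'M[R]_(p, n)) (B : 'M[R]_(p, m)).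

Lemma convex_Omega : @convex_set R _ (Omega A B).
Proof.
move=> x y l; rewrite !inE.
suff H (a b : R) (Y1 Y2 : 'M[R]_(n, m)) (W1 W2 : 'M[R]_n) :
    0 <= a -> 0 <= b -> a + b = 1 -> Omega A B (Y1, W1) -> Omega A B (Y2, W2) ->
    Omega A B (a *: Y1 + b *: Y2, a *: W1 + b *: W2).
  case: x y => [Y1 W1] [Y2 W2].
  by apply: (H l%:num (1 - l%:num)); rewrite ?subr_ge0 ?subrKC.
move=> a_ge0 b_ge0 ab1 [/= sW1 AY1 [_ P1]] [/= sW2 AY2 [_ P2]].
set Y := a *: Y1 + b *: Y2; set W := a *: W1 + b *: W2.
have symW : symmx W by rewrite /symmx /= linearD !linearZ /= sW1 sW2.
split => //=.
  by rewrite mulmxDr -!scalemxAr AY1 AY2 -scalerDl ab1 scale1r.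
split=> [|V KV].
  by rewrite /symmx /= linearD linearZ /= trmx_mul trmxK symW.
have bE : b = 1 - a by rewrite -ab1 addrC addKr.
have AD0 : A *m (Y1 - Y2) = 0 by rewrite mulmxBr AY1 AY2 subrr.
have D_ge0 := trace_KA_ge0 KV AD0.
(* The convexity defect is - (a b / 2) D D^T with D = Y1 - Y2, so its pairing with [V] is
   nonpositive. *)
have -> : 2^-1 *: (Y *m Y^T) + W =
    a *: (2^-1 *: (Y1 *m Y1^T) + W1) + b *: (2^-1 *: (Y2 *m Y2^T) + W2)
    - (2^-1 * a * b) *: ((Y1 - Y2) *m (Y1 - Y2)^T).
  have -> : Y^T = a *: Y1^T + b *: Y2^T by rewrite linearD !linearZ.
  have -> : (Y1 - Y2)^T = Y1^T - Y2^T by rewrite linearB.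
  rewrite /Y /W !mulmxDl !mulmxDr.
  rewrite !mulNmx !mulmxN -!scalemxAl -!scalemxAr opprK.
  move: (Y1 *m _) (Y1 *m _) (Y2 *m _) (Y2 *m _) => Y11 Y12 Y21 Y22.
  by apply/matrixP => i j; rewrite !mxE bE; ring.
rewrite mulmxBl mulmxDl -!scalemxAl linearB linearD !linearZ /=.
(* The bound 0 is written as 0 + 0 + 0 to compare the three summands separately. *)
rewrite -[leRHS]addr0 -[X in _ <= X + _]addr0.
do 2?apply: lerD; apply: mulr_ge0_le0; rewrite ?oppr_le0 ?mulr_ge0//.
- exact: P1.
- exact: P2.
Qed.

(** Induction on the number of columns of [C], with [Y] general because each step shifts it. An
    arbitrary convex [S] containing D suits the hull, the smallest such set. *)
Lemma convex_set_Dset_sub (m_gt0 : (0 < m)%N)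
    (S : set ('M[R]_(n, m) * 'M[R]_n)) (k : nat)
    (C : 'M[R]_(n, k)) (Y : 'M[R]_(n, m)) :
  @convex_set R _ S -> Dset A B `<=` S -> A *m Y = B -> A *m C = 0 ->
  S (Y, - (2^-1 *: (Y *m Y^T + C *m C^T))).
Proof.
move=> cS DS; elim: k C Y => [|k IHk].
  move=> C Y AY _; rewrite (_ : C = 0) ?mul0mx ?addr0.
    by apply: DS; exists Y.
  by apply/matrixP => ? [].
rewrite -[k.+1]/(1 + k)%N => C Y AY AC.
pose v := lsubmx C; pose C' := rsubmx C.
have defC : C = row_mx v C' by rewrite hsubmxK.
have [Av AC'] : A *m v = 0 /\ A *m C' = 0.
  by apply: eq_row_mx; rewrite -mul_mx_row -defC AC row_mx0.
pose j0 : 'I_m := Ordinal m_gt0.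
(* [E] has [v] as its column [j0] and zeros elsewhere; m > 0 provides this column. *)
pose E : 'M[R]_(n, m) := v *m delta_mx 0 j0.
have AE : A *m E = 0 by rewrite mulmxA Av mul0mx.
have EE : E *m E^T = v *m v^T.
  rewrite trmx_mul mulmxA -(mulmxA v) trmx_delta mul_delta_mx.
  rewrite [delta_mx 0 0](_ : _ = 1%:M) ?mulmx1//.
  by apply/matrixP => i j; rewrite !ord1 !mxE.
have YpE : A *m (Y + E) = B by rewrite mulmxDr AY AE addr0.
have YmE : A *m (Y - E) = B by rewrite mulmxBr AY AE subr0.
(* The cross terms Y E^T and E Y^T cancel in the midpoint, leaving Y Y^T + v v^T + C' C'^T. *)
have := convex_set_midpoint cS (IHk _ _ YpE AC') (IHk _ _ YmE AC').
congr (S _); congr (_, _).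
  by apply/matrixP => i j; rewrite !mxE; field.
rewrite defC tr_row_mx mul_row_col -EE.
have -> : (Y + E)^T = Y^T + E^T by rewrite linearD.
have -> : (Y - E)^T = Y^T - E^T by rewrite linearB.
rewrite !mulmxDl !mulmxDr !mulNmx !mulmxN opprK.
move: (Y *m _) (Y *m _) (E *m _) (E *m _) (C' *m _) => M1 M2 M3 M4 M5.
by apply/matrixP => i j; rewrite !mxE; field.
Qed.

Lemma Omega_sub_conv_hull (m_gt0 : (0 < m)%N) :
  Omega A B `<=` conv_hull (Dset A B).
Proof.
move=> [Y W] [/= symW AY /polar_KA_factor [C AC0 defW]] S [cS DS].
have -> : W = - (2^-1 *: (Y *m Y^T + C *m C^T)).
  by rewrite scalerDr opprD -defW addKr.
exact: convex_set_Dset_sub.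
Qed.

(** On D the matrix tested against the polar cone is 0. *)
Lemma Dset_sub_Omega : Dset A B `<=` Omega A B.
Proof.
move=> _ [Y /= AY <-].
have sym : symmx (- (2^-1 *: (Y *m Y^T))).
  by rewrite /symmx /= linearN linearZ /= trmx_mul trmxK.
split => //=; rewrite subrr; split=> [|V _]; first by rewrite /symmx /= trmx0.
by rewrite mul0mx mxtrace0.
Qed.

End Hull.

(** * Closedness of Omega *)

Section Closed.
Variable R : realType.

(** Continuity is stated entrywise, so that products and traces reduce to finite sums of scalar
    functions. *)
Definition continuous_mx (T : topologicalType) (m n : nat)
    (f : T -> 'M[R]_(m, n)) := forall i j, continuous (fun x => f x i j).

Variable T : topologicalType.

Lemma continuous_continuous_mx m n (f : T -> 'M[R]_(m, n)) :
  continuous f -> continuous_mx f.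
Proof.
move=> cf i j x; apply: (@cvg_comp _ _ _ f (fun M => M i j) _ _ _ (cf x)).
exact: coord_continuous.
Qed.

Lemma continuous_mx_cst m n (M : 'M[R]_(m, n)) : continuous_mx (fun _ : T => M).
Proof. by move=> i j; exact: cst_continuous. Qed.

Lemma continuous_mxD m n (f g : T -> 'M[R]_(m, n)) :
  continuous_mx f -> continuous_mx g -> continuous_mx (fun x => f x + g x).
Proof.
move=> cf cg i j; under eq_fun do rewrite mxE.
by move=> x; apply: continuousD; [exact: cf | exact: cg].
Qed.

Lemma continuous_mxM m n q (f : T -> 'M[R]_(m, n)) (g : T -> 'M[R]_(n, q)) :
  continuous_mx f -> continuous_mx g -> continuous_mx (fun x => f x *m g x).
Proof.
move=> cf cg i j; under eq_fun do rewrite mxE.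
apply: continuous_big => [|k _ x]; first exact: add_continuous.
by apply: continuousM; [exact: cf | exact: cg].
Qed.

Lemma continuous_mx_tr m n (f : T -> 'M[R]_(m, n)) :
  continuous_mx f -> continuous_mx (fun x => (f x)^T).
Proof. by move=> cf i j; under eq_fun do rewrite mxE; exact: cf. Qed.

Lemma continuous_mxtrace n (f : T -> 'M[R]_n) :
  continuous_mx f -> continuous (fun x => \tr (f x)).
Proof.
by move=> cf; apply: continuous_big => [|k _]; [exact: add_continuous | exact: cf].
Qed.

Lemma continuous_mx_closed_eq m n (f g : T -> 'M[R]_(m, n)) :
  continuous_mx f -> continuous_mx g -> closed [set x | f x = g x].
Proof.
move=> cf cg.
have -> : [set x | f x = g x] =
    \bigcap_(ij in [set: 'I_m * 'I_n])
      (fun x => f x ij.1 ij.2 - g x ij.1 ij.2) @^-1` [set 0].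
  apply/seteqP; split=> [x /= fg ij _|x fg] /=; first by rewrite fg subrr.
  by apply/matrixP => i j; apply/eqP; rewrite -subr_eq0; apply/eqP/(fg (i, j)).
apply: closed_bigI => ij _; apply: preimage_closed; last exact: closed_eq.
by move=> x _; apply: continuousB; [exact: cf | exact: cg].
Qed.

End Closed.

Lemma closed_Omega (R : realType) (p n m : nat) (A : 'M[R]_(p, n))
    (B : 'M[R]_(p, m)) : closed (Omega A B).
Proof.
pose T := ('M[R]_(n, m) * 'M[R]_n)%type.
have cY : continuous_mx (fun x : T => x.1).
  by apply: continuous_continuous_mx => x; exact: cvg_fst.
have cW : continuous_mx (fun x : T => x.2).
  by apply: continuous_continuous_mx => x; exact: cvg_snd.
have cYW : continuous_mx (fun x : T => 2^-1 *: (x.1 *m x.1^T) + x.2).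
  apply: continuous_mxD => //.
  (* Scaling becomes a product with a constant scalar matrix, covered by [continuous_mxM]. *)
  under eq_fun do rewrite -mul_scalar_mx.
  apply: continuous_mxM; first exact: continuous_mx_cst.
  by apply: continuous_mxM => //; exact: continuous_mx_tr.
pose f (x : T) := 2^-1 *: (x.1 *m x.1^T) + x.2.
(* Omega is cut out by continuous equations and, for each [V] in K_A, one weak inequality between
   continuous functions. *)
have -> : Omega A B = [set x | x.2^T = x.2] `&` [set x | A *m x.1 = B] `&`
  ([set x | (f x)^T = f x] `&`
   \bigcap_(V in KA A) (fun x => \tr (f x *m V)) @^-1` [set r | r <= 0]).
  by apply/seteqP; split=> [x [? ? [? ?]]|x [[? ?] [? ?]]]; do ?split.
apply: closedI; apply: closedI.
- by apply: continuous_mx_closed_eq => //; exact: continuous_mx_tr.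
- apply: continuous_mx_closed_eq; last exact: continuous_mx_cst.
  by apply: continuous_mxM => //; exact: continuous_mx_cst.
- by apply: continuous_mx_closed_eq => //; exact: continuous_mx_tr.
- apply: closed_bigI => V _; apply: preimage_closed; last exact: closed_le.
  move=> x _; apply: continuous_mxtrace.
  by apply: continuous_mxM => //; exact: continuous_mx_cst.
Qed.

(* The case m = 0 must be excluded: D(A,B) is then a single point while
   Omega(A,B) still contains every W in the polar of K_A. *)
Theorem theorem2p2 (R : realType) (p n m : nat) (m_gt0 : (0 < m)%N)
    (A : 'M[R]_(p, n)) (B : 'M[R]_(p, m)) (rgeBA : rge B `<=` rge A) :
  closure (conv_hull (Dset A B)) = Omega A B.
Proof.
apply/seteqP; split; last first.
  exact: subset_trans (Omega_sub_conv_hull m_gt0) (@subset_closure _ _).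
(* Omega equals its closure, so it suffices that Omega contains the hull, hence that it is convex
   and contains D. *)
rewrite [X in _ `<=` X](closure_id _).1; last exact: closed_Omega.
apply: closure_subset; apply: smallest_sub; first exact: convex_Omega.
exact: Dset_sub_Omega.
Qed.
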